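(* Let $s\ge 3$ and $n,k\ge 1$ be integers, let $\mathbb{F}_q$ be a finite field with $q>sn>k$, let $\gamma$ be a generator of $\mathbb{F}_q^\times$, and let $(\alpha_1,\dots,\alpha_n)\in\mathbb{F}_q^n$ be appropriate. Put $R=\frac{k}{sn}$. Then the folded Reed--Solomon code $\mathsf{FRS}_{n,k}^{(s,\gamma)}(\alpha_1,\dots,\alpha_n)$ is $\left(\frac12-\frac{sR}{s-2},2,3\right)$ list-recoverable.
   Context: Appropriate: $(\alpha_1,\dots,\alpha_n)\in\mathbb{F}_q^n$ is appropriate (with respect to $s$ and the generator $\gamma$) if the $sn$ elements $\gamma^i\alpha_j$, $i\in\{0,\dots,s-1\}$, $j\in\{1,\dots,n\}$, are pairwise distinct. Folded Reed--Solomon code: $\mathsf{FRS}^{(s,\gamma)}_{n,k}(\alpha_1,\dots,\alpha_n)=\{\mathcal{C}(f): f\in\mathbb{F}_q[x],\ \deg f<k\}\subseteq(\mathbb{F}_q^s)^n$, where $\mathcal{C}(f)=(F_1,\dots,F_n)$ and $F_i=(f(\alpha_i),f(\gamma\alpha_i),\dots,f(\gamma^{s-1}\alpha_i))\in\mathbb{F}_q^s$. Its rate is $R=\frac{k}{sn}$. List-recoverability: a code $C\subseteq\Sigma^n$ is $(\rho,\ell,L)$ list-recoverable if for all subsets $S_1,\dots,S_n\subseteq\Sigma$ with $|S_i|\le\ell$ for every $i$, there are at most $L$ codewords $c\in C$ such that the number of indices $i\in\{1,\dots,n\}$ with $c_i\notin S_i$ is at most $\rho n$. (If $\rho<0$ this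 holds vacuously.) *)

(* Defs.v *)
From HB Require Import structures.
From mathcomp Require Import all_boot all_order all_fingroup all_algebra all_solvable.

Set Implicit Arguments.
Unset Strict Implicit.
Unset Printing Implicit Defensive.

Import GRing.Theory.
Local Open Scope ring_scope.

Definition appropriate (F : finFieldType) (s n : nat) (gamma : F)
    (alpha : 'I_n -> F) : Prop :=
  injective (fun ij : 'I_s * 'I_n => gamma ^+ ij.1 * alpha ij.2).

Definition frs_encode (F : finFieldType) (s n : nat) (gamma : F)
    (alpha : 'I_n -> F) (f : {poly F}) : {ffun 'I_n -> 'rV[F]_s} :=
  [ffun j => \row_(i < s) f.[gamma ^+ i * alpha j]].

(* [{poly_k F}] is the (finite) type of polynomials of size at most k, that is,
   of degree < k, the zero polynomial included. *)
Definition FRS (F : finFieldType) (s n k : nat) (gamma : F)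
    (alpha : 'I_n -> F) : {set {ffun 'I_n -> 'rV[F]_s}} :=
  [set frs_encode s gamma alpha (f : {poly F}) | f : {poly_k F}].

Definition list_recoverable (Sigma : finType) (n : nat)
    (C : {set {ffun 'I_n -> Sigma}}) (rho : rat) (l L : nat) : Prop :=
  forall S : 'I_n -> {set Sigma}, (forall i, #|S i| <= l)%N ->
    (#|[set c in C | (#|[set i | c i \notin S i]|%:R <= rho * n%:R)%R]| <= L)%N.

Definition frs_rate (s n k : nat) : rat := k%:R / (s * n)%:R.

(* Main.v *)
(* Suppose four distinct polynomials [f_0, ..., f_3] survive. Let [D] have rows
   [f_a - f_0] ([a > 0]), let [d <= 3] be its rank, and let [e_i] be the dimension of the
   space of polynomials in the row space of [D] vanishing on the [i]-th folded
   coordinate. The folded Wronskian of a basis is a nonzero polynomial of degree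
   at most [d (k - 1)] that vanishes to order [e_i] at [s - d + 1] points of
   each block, so [(s - d + 1) sum_i e_i <= d (k - 1)]. As [|S_i| <= 2], more
   than two agreements at [i] force a collision: the number of agreements is at
   most [2 + e_i] if [d = 3], and at most [2 + 2 e_i] if [d <= 2]. In both cases
   the total excess over [2 n] is at most [4 (k - 1) / (s - 2)], whereas the
   decoding radius requires at least [4 k / (s - 2)]. *)
Require Import Defs.
From mathcomp Require Import all_boot all_order all_fingroup all_algebra all_solvable.
From mathcomp Require Import zify ring lra.

Import GRing.Theory.
Local Open Scope ring_scope.

Set Implicit Arguments.
Unset Strict Implicit.
Unset Printing Implicit Defensive.

(** * Coefficients and divisors of products and determinants *)

Lemma mulr_sign_poly (R : nzRingType) m (p : {poly R}) :
  (-1) ^+ m * p = (-1) ^+ m *: p.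
Proof. by rewrite -[in RHS]mul_polyC rmorphXn rmorphN1. Qed.

Lemma coef_prod_top (R : comNzRingType) (I : Type) (r : seq I)
    (p : I -> {poly R}) (e : I -> nat) :
  (forall i, size (p i) <= (e i).+1)%N ->
  (\prod_(i <- r) p i)`_(\sum_(i <- r) e i) = \prod_(i <- r) (p i)`_(e i).
Proof.
move=> szp.
suff [] : (size (\prod_(i <- r) p i)%R <= (\sum_(i <- r) e i).+1)%N /\
  (\prod_(i <- r) p i)`_(\sum_(i <- r) e i) = \prod_(i <- r) (p i)`_(e i) by [].
elim: r => [|i r [IHs IHc]]; first by rewrite !big_nil coef1 size_poly1.
rewrite !big_cons; set q := \prod_(j <- r) p j in IHs IHc *.
set d := (\sum_(j <- r) e j)%N in IHs IHc *; split.
  apply: leq_trans (size_polyMleq _ _) _; have := szp i; lia.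
rewrite coefM (bigD1 (inord (e i) : 'I_(e i + d).+1)) //=.
rewrite inordK ?ltnS ?leq_addr // addKn IHc [X in _ + X]big1 ?addr0 // => j.
rewrite -val_eqE /= inordK ?ltnS ?leq_addr // => ji.
have [ltij|] := ltnP (e i) j.
  by rewrite [(p i)`_j]nth_default ?mul0r // (leq_trans (szp i)).
move=> leji; rewrite [q`__]nth_default ?mulr0 //; apply: leq_trans IHs _; lia.
Qed.

Lemma dvdp_prod_coprime (F : fieldType) (I : finType) (p : I -> {poly F}) q :
  (forall i, p i %| q) -> (forall i j, i != j -> coprimep (p i) (p j)) ->
  \prod_i p i %| q.
Proof.
move=> pq cop; elim: (index_enum I) (index_enum_uniq I) => [|i r IHr] /=.
  by rewrite big_nil dvd1p.
case/andP=> ir /IHr; rewrite big_cons Gauss_dvdp ?pq // => {IHr}.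
elim: r ir => [|j r IHr]; first by rewrite big_nil coprimep1.
by rewrite inE negb_or big_cons coprimepMr => /andP[/cop -> /IHr].
Qed.

Lemma dvdp_det_rows (F : fieldType) d (N : 'M[{poly F}]_d) (v : 'I_d -> {poly F}) :
  (forall a b, v a %| N a b) -> \prod_a v a %| \det N.
Proof.
move=> vN; have -> : N = diag_mx (\row_a v a) *m \matrix_(a, b) (N a b %/ v a).
  by apply/matrixP => a b; rewrite mul_diag_mx !mxE mulrC divpK.
rewrite det_mulmx det_diag dvdp_mulr // [X in _ %| X](eq_bigr v) // => a _.
by rewrite mxE.
Qed.

(** * Folded Wronskians and subspace design *)

Section Wronskian.
Variables (F : fieldType) (g : F) (k : nat).

(** Right multiplication by this matrix sends the coefficient row of a polynomial to its folded
    symbol at [x]. *)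
Definition folded_eval s (x : F) : 'M[F]_(k, s) :=
  Vandermonde k (\row_(t < s) (g ^+ t * x)).

Definition folded_generic d : 'M[{poly F}]_(k, d) :=
  Vandermonde k (\row_(t < d) (g ^+ t *: 'X)).

(** The determinant of the [f_a(g^b X)], where [f_a] has its coefficients in row [a] of [B]: the
    shifts by powers of [g] replace the derivatives of the classical Wronskian. *)
Definition folded_wronskian d (B : 'M[F]_(d, k)) : {poly F} :=
  \det (map_mx polyC B *m folded_generic d).

Lemma coef_folded_generic m d (B : 'M[F]_(m, k)) a b e :
  ((map_mx polyC B *m folded_generic d) a b)`_e =
  (rVpoly (row a B))`_e * g ^+ e ^+ b.
Proof.
rewrite mxE coef_sum coef_rVpoly.
have E (j : 'I_k) : (map_mx polyC B a j * folded_generic d j b)`_e =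
    B a j * (g ^+ b) ^+ j * (e == j)%:R.
  by rewrite !mxE coefCM exprZn coefZ coefXn mulrA.
under eq_bigr => j _ do rewrite E.
case: insubP => [j _ <-|].
  rewrite (bigD1 j) //= eqxx mulr1 mxE exprAC big1 ?addr0 // => i ij.
  by rewrite val_eqE eq_sym (negPf ij) mulr0.
rewrite -leqNgt mul0r => ke; rewrite big1 // => j _.
by rewrite gtn_eqF ?mulr0 // (leq_trans (ltn_ord j)).
Qed.

Lemma row_folded_eval m s (B : 'M[F]_(m, k)) x a t :
  (B *m folded_eval s x) a t = (rVpoly (row a B)).[g ^+ t * x].
Proof.
rewrite mxE horner_poly; apply: eq_bigr => j _; rewrite !mxE.
by rewrite valK mxE.
Qed.

Lemma horner_folded_generic m d s (B : 'M[F]_(m, k)) a (b : 'I_d) (c : 'I_s)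
    (t : nat) x :
  (b + t)%N = c ->
  ((map_mx polyC B *m folded_generic d) a b).[g ^+ t * x] =
  (B *m folded_eval s x) a c.
Proof.
move=> btc; rewrite !mxE horner_sum; apply: eq_bigr => j _.
by rewrite !mxE hornerM hornerC horner_exp hornerZ hornerX mulrA -exprD btc.
Qed.

Lemma folded_wronskianM d (P : 'M[F]_d) (B : 'M[F]_(d, k)) :
  folded_wronskian (P *m B) = (\det P)%:P * folded_wronskian B.
Proof. by rewrite /folded_wronskian map_mxM -mulmxA det_mulmx det_map_mx. Qed.

Lemma size_folded_generic m d (B : 'M[F]_(m, k)) a b :
  (size ((map_mx polyC B *m folded_generic d) a b) <= size (rVpoly (row a B)))%N.
Proof.
apply/leq_sizeP => j szj; rewrite coef_folded_generic.
by rewrite nth_default ?mul0r.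
Qed.

Lemma size_folded_wronskian d (B : 'M[F]_(d, k)) :
  (size (folded_wronskian B) <= (d * k.-1).+1)%N.
Proof.
apply: leq_trans (size_sum _ _ _) _; apply/bigmax_leqP => sg _.
rewrite mulr_sign_poly; apply: leq_trans (size_scale_leq _ _) _.
apply: leq_trans (size_poly_prod_leq _ _) _; rewrite card_ord.
have: (\sum_(i < d) size ((map_mx polyC B *m folded_generic d) i (sg i)) <=
       \sum_(i < d) k)%N.
  apply: leq_sum => i _; apply: leq_trans (size_folded_generic _ _ _) _.
  exact: size_poly.
rewrite sum_nat_const card_ord; move: (\sum_(i < d) size _)%N => S.
case: (k) => [|k'] /=; nia.
Qed.

(** Row operations leave [d - r] polynomials whose folded symbol at [x] is zero. Since [t + d <= s],
    all their shifts at [g ^+ t * x] stay inside that symbol, so each of these rows contributes one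
    linear factor. *)
Lemma dvdp_folded_wronskian d s (B : 'M[F]_(d, k)) x t : (t + d <= s)%N ->
  ('X - (g ^+ t * x)%:P) ^+ (d - \rank (B *m folded_eval s x))
    %| folded_wronskian B.
Proof.
move=> tds; set M := B *m _; set r := \rank M; set L := 'X - _.
have rd : (r <= d)%N := rank_leq_row M.
pose P := invmx (col_ebase M).
have PM : P *m B *m folded_eval s x = pid_mx r *m row_ebase M.
  by rewrite -mulmxA -/M -{1}(mulmx_ebase M) -mulmxA mulKmx ?col_ebase_unit.
have : L ^+ (d - r) %| folded_wronskian (P *m B).
  pose v (a : nat) := if (a < r)%N then 1 else L.
  suff <- : \prod_(a < d) v a = L ^+ (d - r).
    apply: dvdp_det_rows => a b; rewrite /v; case: ltnP => [_|ra].
      exact: dvd1p.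
    have bts : (b + t < s)%N by have := ltn_ord b; lia.
    rewrite dvdp_XsubCl rootE.
    rewrite (@horner_folded_generic _ _ s _ _ _ (Ordinal bts)) // PM mxE.
    by rewrite big1 // => j _; rewrite mxE [(a < r)%N]ltnNge ra andbF mul0r.
  rewrite -(big_mkord xpredT v) (big_cat_nat (leq0n r) rd) /=.
  rewrite big_nat big1 => [|i /andP[_ ir]]; last by rewrite /v ir.
  rewrite mul1r -prodr_const_nat !big_nat; apply: eq_bigr => i /andP[ri _].
  by rewrite /v ltnNge ri.
by rewrite folded_wronskianM mul_polyC dvdpZr // -unitfE -unitmxE unitmx_inv
  col_ebase_unit.
Qed.

Hypothesis gP : {in gtn k &, injective (fun j => g ^+ j)}.

(* Distinct degrees [e_a] make the top coefficient of the determinant a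
   Vandermonde determinant in the [g ^+ e_a]; a degree collision is removed
   by a row operation. *)
Lemma folded_wronskian_neq0 d (B : 'M[F]_(d, k)) :
  row_free B -> folded_wronskian B != 0.
Proof.
pose sz (A : 'M[F]_(d, k)) a := size (rVpoly (row a A)).
(* Induction on the total size of the row polynomials, which the row operation lowers. *)
move: {2}(\sum_a sz B a).+1%N (ltnSn (\sum_a sz B a)) => N.
elim: N B => // N IHN B szB frB.
have nz a : (0 < sz B a)%N.
  rewrite lt0n size_poly_eq0; apply/eqP => ra.
  have : row a B = 0 by rewrite -[LHS]rVpolyK ra linear0.
  rewrite rowE -[RHS](mul0mx _ B) => /(row_free_inj frB)/rowP/(_ a)/eqP.
  by rewrite !mxE !eqxx oner_eq0.
have [/injectiveP inj|/injectivePn[a [b ab eqab]]] := boolP (injectiveb (sz B)).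
  pose e a := (sz B a).-1.
  suff : (folded_wronskian B)`_(\sum_a e a) != 0.
    by apply: contraNneq => ->; rewrite coef0.
  have -> : (folded_wronskian B)`_(\sum_a e a) =
    \det (\matrix_(a, b) ((rVpoly (row a B))`_(e a) * g ^+ e a ^+ b) : 'M_d).
    rewrite coef_sum; apply: eq_bigr => sg _.
    rewrite mulr_sign_poly coefZ coef_prod_top; first congr (_ * _).
      by apply: eq_bigr => i _; rewrite coef_folded_generic !mxE.
    by move=> i; rewrite prednK // size_folded_generic.
  have -> : (\matrix_(a, b) ((rVpoly (row a B))`_(e a) * g ^+ e a ^+ b)) =
     diag_mx (\row_a lead_coef (rVpoly (row a B))) *m
     (Vandermonde d (\row_a g ^+ e a))^T.
    by apply/matrixP => a b; rewrite mul_diag_mx !mxE.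
  rewrite det_mulmx det_diag det_tr det_Vandermonde mulf_neq0 //.
    by apply/prodf_neq0 => a _; rewrite mxE lead_coef_eq0 -size_poly_gt0 nz.
  apply/prodf_neq0 => a _; apply/prodf_neq0 => b ab; rewrite !mxE subr_eq0.
  have ek c : e c \in gtn k by rewrite inE /= /e prednK ?nz // size_poly.
  apply: contraTneq ab => /gP-/(_ (ek _) (ek _)) eab.
  have /inj -> : sz B b = sz B a.
    by rewrite -(prednK (nz a)) -(prednK (nz b)) -/(e a) -/(e b) eab.
  by rewrite ltnn.
(* As rows [a] and [b] have equal size, this multiple of row [b] cancels the leading term of row
   [a]. *)
pose la := lead_coef (rVpoly (row a B)) / lead_coef (rVpoly (row b B)).
have lb0 : lead_coef (rVpoly (row b B)) != 0.
  by rewrite lead_coef_eq0 -size_poly_gt0 nz.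
pose P : 'M[F]_d := 1%:M - la *: delta_mx a b.
have Pu : P \in unitmx.
  have /mulmx1_unit[] // : P *m (1%:M + la *: delta_mx a b) = 1%:M.
  rewrite mulmxDr mulmx1 mulmxBl mul1mx -scalemxAl -scalemxAr.
  by rewrite mul_delta_mx_0 1?eq_sym // !scaler0 subr0 subrK.
have: folded_wronskian (P *m B) != 0.
  apply: IHN; last by rewrite /row_free eqmxMfull ?row_full_unit.
  rewrite ltnS in szB; apply: leq_trans szB.
  rewrite (bigD1 a) //= [X in (_ < X)%N](bigD1 a) //= -addSn leq_add //.
    rewrite /sz row_mul.
    have -> : row a P *m B = row a B - la *: row b B.
      rewrite !rowE /P mulmxBr mulmx1 -scalemxAr mul_delta_mx mulmxBl.
      by rewrite -scalemxAl.
    rewrite linearB linearZ /=.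
    have szab := eqab; rewrite /sz in szab.
    have nza : (0 < size (rVpoly (row a B)))%N := nz a.
    rewrite -[X in (_ < X)%N]prednK // ltnS; apply/leq_sizeP => j.
    rewrite leq_eqVlt => /orP[/eqP <-|ltj].
      rewrite coefB coefZ -/(lead_coef _).
      by rewrite szab -/(lead_coef _) /la divfK ?subrr.
    by rewrite coefB coefZ !nth_default ?mulr0 ?subr0 -?szab // -(prednK nza).
  apply: leq_sum => c ca; rewrite /sz row_mul.
  have -> : row c P *m B = row c B; last by [].
  by rewrite !rowE /P mulmxBr mulmx1 -scalemxAr mul_delta_mx_0 // scaler0 subr0.
by rewrite folded_wronskianM; apply: contraNneq => ->; rewrite mulr0.
Qed.

(* The subspace design property of folded Reed-Solomon codes: the [i]-th term
   is the dimension of the space of polynomials in the row space of [D] that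
   vanish on the [i]-th folded coordinate. *)
Lemma folded_subspace_design m n s (D : 'M[F]_(m, k)) (alpha : 'I_n -> F) :
  (\rank D <= s)%N ->
  injective (fun ij : 'I_s * 'I_n => g ^+ ij.1 * alpha ij.2) ->
  ((s - \rank D).+1 * \sum_i (\rank D - \rank (D *m folded_eval s (alpha i)))
     <= \rank D * k.-1)%N.
Proof.
move=> ds inj; set d := \rank D.
have [d0|d_gt0] := posnP d; first by rewrite d0 big1 ?muln0.
(* A basis makes the Wronskian nonzero, and has the same row space as [D], hence the same ranks. *)
pose B := row_base D.
pose e i := (d - \rank (B *m folded_eval s (alpha i)))%N.
have eE i : (d - \rank (D *m folded_eval s (alpha i)))%N = e i.
  by rewrite /e (eqmxMr _ (eq_row_base D)).
under eq_bigr => i _ do rewrite eE.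
(* The shifts [t] with [t + d <= s] number [s - d + 1]; the roots are distinct by [inj], so the
   product of these powers divides the Wronskian. *)
pose p (ti : 'I_(s - d).+1 * 'I_n) :=
  ('X - (g ^+ ti.1 * alpha ti.2)%:P) ^+ e ti.2.
have W0 : folded_wronskian B != 0 by rewrite folded_wronskian_neq0 ?row_base_free.
have: \prod_ti p ti %| folded_wronskian B.
  apply: dvdp_prod_coprime => [[t i]|[t i] [u j] tiuj]; rewrite /p /=.
    by apply: dvdp_folded_wronskian; have := ltn_ord t; lia.
  rewrite coprimep_expl // coprimep_expr // coprimep_XsubC2 // subr_eq0.
  have lts (w : 'I_(s - d).+1) : (w < s)%N by have := ltn_ord w; lia.
  apply: contra_neq tiuj => E.
  have [] := inj (Ordinal (lts u), j) (Ordinal (lts t), i) E.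
  by move=> ut ->; congr pair; apply/val_inj.
move/(dvdp_leq W0)/leq_trans/(_ (size_folded_wronskian B)).
rewrite size_prod => [|ti _]; last by rewrite expf_neq0 ?polyXsubC_eq0.
under eq_bigr => ti _ do rewrite size_exp_XsubC -addn1.
rewrite big_split /= sum1_card -addSn addnK ltnS.
by rewrite -(pair_bigA _ (fun t i => e i)) /= sum_nat_const card_ord.
Qed.

End Wronskian.

(** * Agreements of four words at one coordinate *)

Lemma ltn_rank_mulmx (F : fieldType) m k s (D : 'M[F]_(m, k)) (E : 'M[F]_(k, s))
    (w : 'rV[F]_k) :
  w != 0 -> (w <= D)%MS -> w *m E = 0 -> (\rank (D *m E) < \rank D)%N.
Proof.
move=> w0 wD wE; rewrite -(mxrank_mul_ker D E) -[X in (X < _)%N]addn0 ltn_add2l.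
rewrite lt0n mxrank_eq0; apply: contraNneq w0 => DE0.
by rewrite -submx0 -DE0 sub_capmx wD; apply/sub_kermxP.
Qed.

(** Three agreements with a set of two symbols force a collision, hence a rank loss of at least 1.
    If [D] has rank 3, four agreements must cost a loss of 2; otherwise the factor 2 already allows
    all four. *)
Lemma four_words_agreement (F : finFieldType) k s (E : 'M[F]_(k, s))
    (f : 'I_4 -> 'rV[F]_k) (S : {set 'rV[F]_s}) :
  let D := \matrix_(a < 3) (f (lift ord0 a) - f ord0) in
  injective f -> (#|S| <= 2)%N ->
  (#|[set a | f a *m E \in S]| <=
     2 + (if \rank D == 3 then 1 else 2) * (\rank D - \rank (D *m E)))%N.
Proof.
move=> D injf S2; set T := [set a | _].
have fD a : (f a - f ord0 <= D)%MS.
  case: (unliftP ord0 a) => [b ->|->]; last by rewrite subrr sub0mx.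
  have <- : row b D = f (lift ord0 b) - f ord0 by rewrite rowK.
  exact: row_sub.
have [T2|T3] := leqP #|T| 2; first exact: leq_trans T2 (leq_addr _ _).
have T4 : (#|T| <= 4)%N by rewrite (leq_trans (max_card _)) ?card_ord.
have: (\rank (D *m E) < \rank D)%N.
  have /dinjectivePn[a aT [b /andP[ba bT] fab]] :
      ~~ dinjectiveb (fun a => f a *m E) (mem T).
    apply: contraTN T3 => /dinjectiveP/card_in_imset cT; rewrite -leqNgt -cT.
    apply: leq_trans S2; apply/subset_leq_card/subsetP => y /imsetP[a].
    by rewrite inE => aS ->.
  apply: (@ltn_rank_mulmx _ _ _ _ _ _ (f a - f b)).
  - by rewrite subr_eq0 (inj_eq injf) eq_sym.
  - have -> : f a - f b = (f a - f ord0) - (f b - f ord0).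
      by rewrite opprB addrA subrK.
    by rewrite addmx_sub ?eqmx_opp.
  by rewrite mulmxBl fab subrr.
case: eqP => [D3 DE|_ DE]; last by lia.
have [T3'|T4'] := leqP #|T| 3; first by lia.
have allS a : f a *m E \in S.
  have /eqP TT : T == setT by rewrite eqEcard subsetT cardsT card_ord.
  by have := in_setT a; rewrite -TT inE.
suff: (\rank (D *m E) <= 1)%N by lia.
(* All four symbols lie in [{u, v}], so every difference from [u] is 0 or [v - u]. The default [u]
   covers the case where [S] has no other element. *)
pose u := f ord0 *m E; pose v := odflt u [pick v in S :\ u].
suff: (D *m E <= v - u)%MS by move/mxrankS/leq_trans; apply; apply: rank_leq_row.
apply/row_subP => a; rewrite row_mul rowK mulmxBl -/u.
have [->|au] := eqVneq (f (lift ord0 a) *m E) u; first by rewrite subrr sub0mx.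
have Su : (#|S :\ u| <= 1)%N by move: S2; rewrite (cardsD1 u S) allS.
have aSu : f (lift ord0 a) *m E \in S :\ u by rewrite !inE au allS.
suff -> : v = f (lift ord0 a) *m E by [].
rewrite /v; case: pickP => [v' v'S|/(_ (f (lift ord0 a) *m E))]; last first.
  by rewrite aSu.
exact: (card_le1_eqP Su).
Qed.

(** * Powers of the generator and the decoding radius *)

Lemma generator_expr_inj (F : finFieldType) (g : {unit F}) k :
  generator [set: {unit F}] g -> (k < #|F|)%N ->
  {in gtn k &, injective (fun j => val g ^+ j)}.
Proof.
move=> /eqP gG kF i j; rewrite !inE /= => ik jk; rewrite -!FinRing.val_unitX.
move=> /val_inj/eqP; rewrite eq_expg_mod_order.
have -> : #[g]%g = #|F|.-1 by rewrite orderE -gG card_finField_unit.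
by rewrite !modn_small; [move/eqP | lia | lia].
Qed.

(** Since [sR = k / n], multiplying the radius bound by [2 (s - 2)] clears all denominators. *)
Lemma disagreement_bound (s n k e : nat) :
  (3 <= s)%N -> (1 <= n)%N ->
  (e%:R <= (1 / 2%:R - s%:R * frs_rate s n k / (s%:R - 2%:R)) * n%:R :> rat) ->
  (2 * (s - 2) * e + 2 * k <= n * (s - 2))%N.
Proof.
case: s => [|[|[|t]]] // _; case: n => // n _.
have t0 : (t.+1%:R != 0 :> rat) by rewrite Num.Theory.pnatr_eq0.
rewrite /frs_rate natrM.
have -> : (t.+3%:R - 2%:R = t.+1%:R :> rat) by rewrite -natrB.
have -> : (1 / 2%:R - t.+3%:R * (k%:R / (t.+3%:R * n.+1%:R)) / t.+1%:R) * n.+1%:R =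
    (n.+1%:R / 2 - k%:R / t.+1%:R :> rat).
  by field; rewrite !nat1r -natrD !Num.Theory.pnatr_eq0.
move=> H; rewrite !subSS subn0 -(Num.Theory.ler_nat rat) natrD !natrM.
have {H} : t.+1%:R * e%:R <= t.+1%:R * (n.+1%:R / 2 - k%:R / t.+1%:R) :> rat.
  by rewrite Num.Theory.ler_pM2l // Num.Theory.ltr0n.
rewrite mulrBr [X in _ - X]mulrC divfK //; lra.
Qed.

(** * Counting the agreements of four codewords *)

Theorem theorem1p8 (s n k : nat) (F : finFieldType) (gamma : {unit F})
    (alpha : 'I_n -> F)
    (hs : (3 <= s)%N) (hn : (1 <= n)%N) (hk : (1 <= k)%N)
    (hq : (s * n < #|F|)%N) (hkn : (k < s * n)%N)
    (hgamma : generator [set: {unit F}] gamma)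
    (halpha : appropriate s (val gamma) alpha) :
  list_recoverable (FRS s k (val gamma) alpha)
    (1 / 2%:R - s%:R * frs_rate s n k / (s%:R - 2%:R)) 2 3.
Proof.
move=> S S2; rewrite leqNgt; apply/negP => X4.
set X := [set c in _ | _] in X4.
pose c (a : 'I_4) := enum_val (widen_ord X4 a).
have cX a : c a \in X := enum_valP _.
have cinj : injective c.
  by move=> a b /enum_val_inj/(congr1 val) /= ab; apply/val_inj.
have /fin_all_exists[p cE] a :
    exists p : {poly_k F}, c a = frs_encode s (val gamma) alpha p.
  by have := cX a; rewrite inE => /andP[/imsetP[p _ ->] _]; exists p.
pose f a : 'rV[F]_k := poly_rV (p a : {poly F}).
pose E i := folded_eval (val gamma) k s (alpha i).
have cfE a i : c a i = f a *m E i.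
  rewrite cE ffunE; apply/rowP => t; rewrite row_folded_eval mxE.
  by rewrite row_id poly_rV_K ?size_npoly.
have finj : injective f.
  by move=> a b fab; apply/cinj/ffunP => i; rewrite !cfE fab.
pose D := \matrix_(a < 3) (f (lift ord0 a) - f ord0).
have D3 : (\rank D <= 3)%N := rank_leq_row D.
have design := folded_subspace_design
  (generator_expr_inj hgamma (ltn_trans hkn hq)) (leq_trans D3 hs) halpha.
pose A a := #|[set i | c a i \in S i]|.
(* Agreements are [n] minus disagreements, and the latter are bounded by the radius. *)
have AE a : (n * (s - 2) + 2 * k <= 2 * (s - 2) * A a)%N.
  have := cX a; rewrite inE => /andP[_ /(disagreement_bound hs hn)].
  have := cardsC [set i | c a i \in S i]; rewrite -/(A a) card_ord.
  have -> : ~: [set i | c a i \in S i] = [set i | c a i \notin S i].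
    by apply/setP => i; rewrite !inE.
  set e := #|_|; nia.
(* Double counting of the pairs of a codeword and a coordinate where it agrees. *)
have sumA : (\sum_a A a = \sum_i #|[set a | f a *m E i \in S i]|)%N.
  under eq_bigr => a _ do rewrite /A -sum1dep_card big_mkcond /=.
  rewrite exchange_big /=; apply: eq_bigr => i _.
  rewrite -sum1dep_card [RHS]big_mkcond /=.
  by apply: eq_bigr => a _; rewrite cfE.
pose K := if \rank D == 3 then 1%N else 2%N.
pose e := (\sum_i (\rank D - \rank (D *m E i)))%N.
have lowA : (4 * (n * (s - 2) + 2 * k) <= 2 * (s - 2) * \sum_a A a)%N.
  have <- : (\sum_(a < 4) (n * (s - 2) + 2 * k) = 4 * (n * (s - 2) + 2 * k))%N.
    by rewrite sum_nat_const card_ord.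
  by rewrite big_distrr leq_sum.
have upA : (\sum_a A a <= 2 * n + K * e)%N.
  have <- : (\sum_(i < n) 2 = 2 * n)%N by rewrite sum_nat_const card_ord mulnC.
  rewrite sumA /e big_distrr -big_split /=.
  by apply: leq_sum => i _; apply: four_words_agreement.
(* The product is 3 in rank 3, and at most [2 * 2] in smaller rank. *)
have KD : (K * \rank D <= 4)%N by rewrite /K; case: eqP => [->|]; lia.
(* Rank at most 3 gives [s - 2 <= s - \rank D + 1]. *)
have De : ((s - 2) * e <= \rank D * k.-1)%N.
  by apply: leq_trans design; rewrite leq_mul2r; apply/orP; right; lia.
(* The terms in [n] cancel between [lowA] and [upA]. With [De] and [KD] this gives
   [4 k <= 4 (k - 1)], absurd as [k >= 1]. *)
have : (4 * k <= K * ((s - 2) * e))%N by nia.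
move/leq_trans/(_ (leq_mul (leqnn K) De)); rewrite mulnA.
move/leq_trans/(_ (leq_mul KD (leqnn _))); lia.
Qed.
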